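(* Let $A = (a_{ij})_{i,j=1}^n$ be a real doubly diagonally dominant matrix with $a_{ii} > 0$, $i = 1, \ldots, n$. Then $$\det A \leq \left(\big(\|\mathrm{Skew}(A)\|\,\|(\mathrm{Sym}(A))^{-1}\|\big)^2 + 1\right)^{\frac{n}{2}}\prod_{i=1}^n a_{ii}.$$
   Context: An $n \times n$ matrix $A$ is strictly row diagonally dominant if $|a_{ii}| > \sum_{j\neq i}|a_{ij}|$ for all $i$; strictly column diagonally dominant if $A^T$ is strictly row diagonally dominant; doubly diagonally dominant if it is both strictly row and strictly column diagonally dominant. Notation: $\mathrm{Sym}(A) = \frac{A+A^T}{2}$, $\mathrm{Skew}(A) = \frac{A - A^T}{2}$, and $\|M\| = \sup_{\|x\|=1}\|Mx\|$ is the operator norm induced by the Euclidean norm. *)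

(* Defs.v *)
From mathcomp Require Export all_boot all_order all_algebra.
From mathcomp Require Export classical_sets reals exp.

Set Implicit Arguments.
Unset Strict Implicit.
Unset Printing Implicit Defensive.

Import Order.TTheory GRing.Theory Num.Theory.

Local Open Scope classical_set_scope.
Local Open Scope ring_scope.

Definition strict_row_diag_dominant (R : realType) (n : nat) (A : 'M[R]_n) : Prop :=
  forall i : 'I_n, \sum_(j < n | j != i) `|A i j| < `|A i i|.

Definition strict_col_diag_dominant (R : realType) (n : nat) (A : 'M[R]_n) : Prop :=
  strict_row_diag_dominant A^T.

Definition doubly_diag_dominant (R : realType) (n : nat) (A : 'M[R]_n) : Prop :=
  strict_row_diag_dominant A /\ strict_col_diag_dominant A.

Definition Sym (R : realType) (n : nat) (A : 'M[R]_n) : 'M[R]_n :=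
  2^-1 *: (A + A^T).

Definition Skew (R : realType) (n : nat) (A : 'M[R]_n) : 'M[R]_n :=
  2^-1 *: (A - A^T).

(* The library's norm [`|x|] on matrices is the maximum norm, hence the
   separate Euclidean norm. *)
Definition euclidean_norm (R : realType) (n : nat) (x : 'cV[R]_n) : R :=
  Num.sqrt (\sum_(i < n) x i 0 ^+ 2).

(* The supremum is over a bounded set, nonempty when 0 < n; for n = 0 the
   set is empty and [sup set0 = 0]. *)
Definition operator_norm (R : realType) (n : nat) (M : 'M[R]_n) : R :=
  sup [set euclidean_norm (M *m x) | x in [set x | euclidean_norm x = 1]].

(* Main.v *)
(* Write [S = Sym A], [K = Skew A].  Diagonal dominance makes [S] positive
   definite, and [P = A S^-1 A^T = (S + K) S^-1 (S - K) = S + K^T S^-1 K] is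
   then positive definite with [(det A)^2 = det S * det P].  Hadamard's inequality
   bounds [det S] by the product of the [a_ii], and [det P] by the product of
   the [P_ii <= a_ii + |K|^2 |S^-1| <= (1 + |K|^2 |S^-1|^2) a_ii], the last step
   because [|S^-1| a_ii >= 1]. *)
Require Import Defs.
From mathcomp Require Import ring lra.
Set Implicit Arguments.
Unset Strict Implicit.
Unset Printing Implicit Defensive.
Import Order.TTheory GRing.Theory Num.Theory.
Local Open Scope ring_scope.

(** * Positive definite matrices: Schur complements, Hadamard's inequality, inverses *)

Definition posdef (R : realType) (n : nat) (P : 'M[R]_n) : Prop :=
  P^T = P /\ forall x : 'cV[R]_n, x != 0 -> 0 < (x^T *m P *m x) 0 0.

Lemma posdef_ge0 (R : realType) (n : nat) (P : 'M[R]_n) (x : 'cV[R]_n) :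
  posdef P -> 0 <= (x^T *m P *m x) 0 0.
Proof.
move=> [_ hP]; have [->|/hP/ltW //] := eqVneq x 0.
by rewrite mulmx0 mxE.
Qed.

Lemma quad_delta (R : realType) (n : nat) (P : 'M[R]_n) (i : 'I_n) :
  ((delta_mx i 0 : 'cV[R]_n)^T *m P *m (delta_mx i 0 : 'cV[R]_n)) 0 0 = P i i.
Proof. by rewrite trmx_delta -rowE -colE !mxE. Qed.

Lemma delta_neq0 (R : realType) (n : nat) (i : 'I_n) :
  (delta_mx i 0 : 'cV[R]_n) != 0.
Proof.
apply/eqP => /matrixP /(_ i 0); rewrite !mxE !eqxx => /eqP.
by rewrite oner_eq0.
Qed.

Lemma posdef_diag (R : realType) (n : nat) (P : 'M[R]_n) (i : 'I_n) :
  posdef P -> 0 < P i i.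
Proof. by case=> _ hP; rewrite -quad_delta; apply/hP/delta_neq0. Qed.

(** The form of the Schur complement at [y] is the form of the block matrix at the vector with lower
    part [y] and first coordinate [- a^-1 *: (b *m y)], the value that minimises it. *)
Lemma schur_posdef (R : realType) (n : nat) (a : R) (b : 'rV[R]_n)
    (D : 'M[R]_n) :
  0 < a -> posdef (block_mx a%:M b b^T D) ->
  posdef (D - a^-1 *: (b^T *m b)).
Proof.
move=> a0 [sP hP]; have a_n0 : a != 0 by rewrite gt_eqF.
split.
  have := congr1 drsubmx sP; rewrite tr_block_mx !block_mxKdr => sD.
  by rewrite linearB linearZ /= trmx_mul trmxK sD.
move=> y y0; set x := col_mx (- a^-1 *: (b *m y)) y.
have x0 : x != 0 by apply: contra y0; rewrite col_mx_eq0 => /andP[].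
have := hP x x0; rewrite -mulmxA mul_block_col tr_col_mx mul_row_col.
have -> : a%:M *m (- a^-1 *: (b *m y)) + b *m y = 0.
  by rewrite mul_scalar_mx scalerA mulrN divff // scaleN1r addNr.
rewrite mulmx0 add0r.
by rewrite -scalemxAr mulmxA addrC scaleNr scalemxAl -mulmxBl mulmxA.
Qed.

Lemma det_schur (R : realType) (n : nat) (a : R) (b : 'rV[R]_n)
    (c : 'cV[R]_n) (D : 'M[R]_n) :
  a != 0 ->
  \det (block_mx a%:M b c D) = a * \det (D - a^-1 *: (c *m b)).
Proof.
move=> a0.
(* One step of Gaussian elimination: a unit lower triangular factor times an upper triangular
   one. *)
have -> : block_mx a%:M b c D = block_mx 1%:M 0 (a^-1 *: c) 1%:M *m
    block_mx a%:M b 0 (D - a^-1 *: (c *m b)).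
  rewrite mulmx_block !mul1mx !mul0mx !addr0.
  by rewrite mul_mx_scalar scalerA divff // scale1r -scalemxAl addrC subrK.
by rewrite det_mulmx det_lblock det_ublock !det1 !mul1r det_scalar1.
Qed.

(** Induction on the size, eliminating the first row and column. The determinant is [P 0 0] times
    that of the Schur complement, whose diagonal entries are those of [P] minus the nonnegative
    numbers [a^-1 * b_i ^+ 2]. *)
Lemma hadamard_posdef (R : realType) (n : nat) (P : 'M[R]_n) :
  posdef P -> 0 < \det P <= \prod_(i < n) P i i.
Proof.
elim: n P => [|n IH] P hP; first by rewrite det_mx00 big_ord0 ltr01 lexx.
have a0 := posdef_diag 0 hP; set a := P 0 0 in a0.
pose Q : 'M[R]_(1 + n) := P.
have EP : P = block_mx a%:M (ursubmx Q) (ursubmx Q)^T (drsubmx Q).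
  have <- : ulsubmx Q = a%:M.
    apply/matrixP => i j; rewrite !ord1 !mxE eqxx mulr1n.
    by congr (P _ _); apply/val_inj.
  have <- : dlsubmx Q = (ursubmx Q)^T by rewrite trmx_ursub; case: hP => ->.
  by rewrite submxK.
set b := ursubmx Q in EP; set D := drsubmx Q in EP.
have := hP; rewrite EP => /(schur_posdef a0) /[dup] /IH /andP[d0 dle] hC.
rewrite det_schur ?gt_eqF // mulr_gt0 //= big_ord_recl -EP.
apply: ler_pM => //; first exact: ltW.
  exact: ltW.
apply: (le_trans dle); apply: ler_prod => i _.
rewrite ltW ?(posdef_diag i hC) //= !mxE big_ord1 !mxE -expr2.
rewrite [P (rshift 1 i) _](_ : _ = P (lift ord0 i) (lift ord0 i)); last first.
  by congr (P _ _); apply/val_inj.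
by rewrite gerBl mulr_ge0 ?sqr_ge0 // invr_ge0 ltW.
Qed.

Lemma posdef_unitmx (R : realType) (n : nat) (P : 'M[R]_n) :
  posdef P -> P \in unitmx.
Proof.
by move=> /hadamard_posdef /andP[d0 _]; rewrite unitmxE unitfE gt_eqF.
Qed.

Lemma posdef_invmx (R : realType) (n : nat) (P : 'M[R]_n) :
  posdef P -> posdef (invmx P).
Proof.
move=> hP; have uP := posdef_unitmx hP; have [sP pP] := hP.
split; first by rewrite trmx_inv sP.
move=> x x0; have := pP (invmx P *m x).
rewrite trmx_mul trmx_inv sP mulmxKV // mulmxA; apply.
apply: contraNneq x0 => h0.
by rewrite -[x](mulKVmx uP) h0 mulmx0.
Qed.

(** By the inequality of arithmetic and geometric means, an off-diagonal term is at least
    [- |S_ij| (x_i^2 + x_j^2) / 2]. As [S] is symmetric, these bounds add up to minus the sum of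
    [x_i^2] weighted by the off-diagonal row sums, which the diagonal dominates. *)
Lemma diag_dominant_posdef (R : realType) (n : nat) (S : 'M[R]_n) :
  S^T = S -> (forall i, 0 < S i i) -> strict_row_diag_dominant S -> posdef S.
Proof.
move=> sS pS dS; split=> // x x0.
have sE i j : S i j = S j i by rewrite -[in LHS]sS mxE.
have [k xk0] : exists k, x k 0 != 0.
  by case/cV0Pn: x0 => k; exists k.
have -> : (x^T *m S *m x) 0 0 = \sum_i \sum_j S i j * (x i 0 * x j 0).
  rewrite -mulmxA mxE; apply: eq_bigr => i _; rewrite !mxE mulr_sumr.
  by apply: eq_bigr => j _; ring.
pose T := \sum_i \sum_(j | j != i) `|S i j| * x i 0 ^+ 2.
have swapT : \sum_i \sum_(j | j != i) `|S i j| * x j 0 ^+ 2 = T.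
  rewrite (exchange_big_dep predT) //=; apply: eq_bigr => i _.
  by apply: eq_big => [j|j _]; rewrite ?(eq_sym i) // sE.
apply: (@lt_le_trans _ _ (\sum_i S i i * x i 0 ^+ 2 - T)).
  (* Every summand is nonnegative, and the nonzero coordinate [k] makes its own positive. *)
  rewrite /T -sumrB (bigD1 k) //=; apply: ltr_wpDr.
    apply: sumr_ge0 => i _; rewrite -mulr_suml -mulrBl mulr_ge0 ?sqr_ge0 //.
    by rewrite subr_ge0 -[leRHS]gtr0_norm // ltW // dS.
  rewrite -mulr_suml -mulrBl mulr_gt0 ?exprn_even_gt0 //.
  by rewrite subr_gt0 -[ltRHS]gtr0_norm // dS.
(* Averaging [T] with its transposed form allows a comparison term by term. *)
have -> : T =
    \sum_i \sum_(j | j != i) `|S i j| * (2^-1 * (x i 0 ^+ 2 + x j 0 ^+ 2)).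
  transitivity (2^-1 * (T + T)); first by field.
  rewrite -{2}swapT -big_split mulr_sumr; apply: eq_bigr => i _ /=.
  by rewrite -big_split mulr_sumr; apply: eq_bigr => j _ /=; ring.
rewrite -sumrB; apply: ler_sum => i _.
rewrite [leRHS](bigD1 i) //= -expr2 lerD2l -sumrN; apply: ler_sum => j _.
have hx : `|x i 0 * x j 0| <= 2^-1 * (x i 0 ^+ 2 + x j 0 ^+ 2).
  by rewrite ler_norml; have := sqr_ge0 (x i 0 - x j 0);
    have := sqr_ge0 (x i 0 + x j 0) => *; apply/andP; split; nra.
rewrite lerNl; apply: le_trans (ler_wpM2l (normr_ge0 _) hx).
by rewrite -normrM -normrN ler_norm.
Qed.

(** * Euclidean norm and operator norm *)

Lemma euclidean_norm_ge0 (R : realType) (n : nat) (x : 'cV[R]_n) :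
  0 <= euclidean_norm x.
Proof. exact: sqrtr_ge0. Qed.

Lemma sqr_euclidean_norm (R : realType) (n : nat) (x : 'cV[R]_n) :
  euclidean_norm x ^+ 2 = \sum_(i < n) x i 0 ^+ 2.
Proof. by rewrite sqr_sqrtr // sumr_ge0 // => i _; rewrite sqr_ge0. Qed.

Lemma euclidean_norm_eq0 (R : realType) (n : nat) (x : 'cV[R]_n) :
  euclidean_norm x = 0 -> x = 0.
Proof.
move=> h; have := sqr_euclidean_norm x; rewrite h expr0n /= => /esym /eqP.
rewrite psumr_eq0 => [/allP h0|i _]; last exact: sqr_ge0.
apply/colP => i; rewrite mxE; apply/eqP.
by have := h0 i (mem_index_enum _); rewrite /= sqrf_eq0.
Qed.

Lemma euclidean_normZ (R : realType) (n : nat) (c : R) (x : 'cV[R]_n) :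
  0 <= c -> euclidean_norm (c *: x) = c * euclidean_norm x.
Proof.
move=> c0; rewrite /euclidean_norm -{2}(ger0_norm c0) -sqrtr_sqr.
rewrite -sqrtrM ?sqr_ge0 //.
by congr Num.sqrt; rewrite mulr_sumr; apply: eq_bigr => i _; rewrite mxE exprMn.
Qed.

Lemma euclidean_norm_delta (R : realType) (n : nat) (i : 'I_n) :
  euclidean_norm (delta_mx i 0 : 'cV[R]_n) = 1.
Proof.
rewrite /euclidean_norm (bigD1 i) //= mxE !eqxx big1 ?addr0 ?expr1n ?sqrtr1 //.
by move=> j /negPf ji; rewrite mxE ji expr0n.
Qed.

(** For [a = |x|] and [b = |y|], the square of [|b x - a y|] expands to [2 a b (a b - x^T y)].
    Vanishing norms are treated apart, so that [2 a b] can be cancelled. *)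
Lemma cauchy_schwarz (R : realType) (n : nat) (x y : 'cV[R]_n) :
  (x^T *m y) 0 0 <= euclidean_norm x * euclidean_norm y.
Proof.
have [x0|x0] := eqVneq (euclidean_norm x) 0.
  by rewrite x0 (euclidean_norm_eq0 x0) trmx0 mul0mx mxE mul0r.
have [y0|y0] := eqVneq (euclidean_norm y) 0.
  by rewrite y0 (euclidean_norm_eq0 y0) mulmx0 mxE mulr0.
set a := euclidean_norm x in x0 *; set b := euclidean_norm y in y0 *.
have a0 : 0 < a by rewrite lt_def x0 euclidean_norm_ge0.
have b0 : 0 < b by rewrite lt_def y0 euclidean_norm_ge0.
have : 0 <= \sum_i (b * x i 0 - a * y i 0) ^+ 2.
  by apply: sumr_ge0 => i _; exact: sqr_ge0.
have -> : \sum_i (b * x i 0 - a * y i 0) ^+ 2 =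
    b ^+ 2 * a ^+ 2 + a ^+ 2 * b ^+ 2 - 2 * (a * b) * (x^T *m y) 0 0.
  rewrite !sqr_euclidean_norm mxE !mulr_sumr -big_split -sumrB /=.
  by apply: eq_bigr => i _; rewrite !mxE -!sqr_euclidean_norm -/a -/b; ring.
rewrite (_ : _ - _ = 2 * (a * b) * (a * b - (x^T *m y) 0 0)); last by ring.
by rewrite pmulr_rge0 ?subr_ge0 // !mulr_gt0.
Qed.

Lemma operator_norm_unit (R : realType) (n : nat) (M : 'M[R]_n)
    (x : 'cV[R]_n) :
  euclidean_norm x = 1 -> euclidean_norm (M *m x) <= operator_norm M.
Proof.
move=> x1; apply: sup_ubound; last by exists x.
(* An upper bound is needed for [sup] to be meaningful. The entries of a unit vector are at most 1
   in absolute value, so each entry of the image is bounded by the absolute row sum of [M]. *)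
exists (Num.sqrt (\sum_i (\sum_j `|M i j|) ^+ 2)) => _ [y /= y1 <-].
rewrite /euclidean_norm ler_sqrt; last first.
  by apply: sumr_ge0 => i _; exact: sqr_ge0.
apply: ler_sum => i _; rewrite -real_normK ?num_real // lerXn2r ?nnegrE //.
  by apply: sumr_ge0.
rewrite mxE; apply: le_trans (ler_norm_sum _ _ _) _; apply: ler_sum => j _.
rewrite normrM ler_piMr // -(ler_pXn2r (n := 2)) ?nnegrE // expr1n.
rewrite real_normK ?num_real // -(expr1n R 2) -y1 sqr_euclidean_norm.
by rewrite (bigD1 j) //= lerDl sumr_ge0 // => k _; exact: sqr_ge0.
Qed.

Lemma operator_normP (R : realType) (n : nat) (M : 'M[R]_n) (x : 'cV[R]_n) :
  euclidean_norm (M *m x) <= operator_norm M * euclidean_norm x.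
Proof.
have [x0|x0] := eqVneq (euclidean_norm x) 0.
  have := euclidean_normZ x (lexx 0); rewrite scale0r mul0r x0 mulr0 => n0.
  by rewrite (euclidean_norm_eq0 x0) mulmx0 n0.
have xp : 0 < euclidean_norm x by rewrite lt_def x0 euclidean_norm_ge0.
have ip : 0 <= (euclidean_norm x)^-1 by rewrite invr_ge0 ltW.
have := @operator_norm_unit _ _ M ((euclidean_norm x)^-1 *: x).
rewrite -scalemxAr !euclidean_normZ // mulVf // => /(_ erefl).
by rewrite mulrC ler_pdivrMr.
Qed.

Lemma operator_norm_quad (R : realType) (n : nat) (M : 'M[R]_n)
    (x : 'cV[R]_n) :
  (x^T *m M *m x) 0 0 <= operator_norm M * euclidean_norm x ^+ 2.
Proof.
rewrite -mulmxA; apply: le_trans (cauchy_schwarz _ _) _.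
by rewrite expr2 mulrA mulrC ler_wpM2r ?euclidean_norm_ge0 ?operator_normP.
Qed.

Lemma operator_norm_invmx_diag (R : realType) (n : nat) (P : 'M[R]_n)
    (i : 'I_n) :
  posdef P -> 1 <= operator_norm (invmx P) * P i i.
Proof.
(* Expand [e - Q e / Q_ii], the [P]-orthogonal component of [e] to [Q e]. *)
move=> hP; have hQ := posdef_invmx hP; have uP := posdef_unitmx hP.
set Q := invmx P in hQ *; have q0 := posdef_diag i hQ.
have p0 := posdef_diag i hP.
(* [Q i i] is the value of the form of [Q] at a unit vector; this leaves [1 <= Q i i * P i i] to
   prove. *)
have qle : Q i i <= operator_norm Q.
  rewrite -quad_delta; apply: le_trans (operator_norm_quad _ _) _.
  by rewrite euclidean_norm_delta expr1n mulr1.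
apply: (@le_trans _ _ (Q i i * P i i)); last by rewrite ler_pM2r.
set e : 'cV[R]_n := delta_mx i 0.
have := posdef_ge0 (e - (Q i i)^-1 *: (Q *m e)) hP.
have -> : ((e - (Q i i)^-1 *: (Q *m e))^T *m P *m
    (e - (Q i i)^-1 *: (Q *m e))) 0 0 = P i i - (Q i i)^-1.
  have QT : Q^T = Q by case: hQ.
  have ee : (e^T *m e) 0 0 = 1.
    by rewrite trmx_delta mul_delta_mx mxE.
  have -> : (e - (Q i i)^-1 *: (Q *m e))^T = e^T - (Q i i)^-1 *: (e^T *m Q).
    by rewrite linearB linearZ /= trmx_mul QT.
  (* As [Q] inverts [P], both cross terms reduce to [e^T e = 1] and the last term to the form of [Q]
     at [e]. *)
  rewrite !mulmxBl !mulmxBr.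
  rewrite -!scalemxAl -!scalemxAr.
  rewrite (mulmxA (e^T *m P)) mulmxK // mulmxKV // mulmxA.
  have -> : forall M1 M2 M3 M4 : 'M[R]_1, (M1 - M2 - (M3 - M4)) 0 0 =
    M1 0 0 - M2 0 0 - M3 0 0 + M4 0 0 by move=> *; rewrite !mxE; ring.
  rewrite ![(_ *: _ : 'M_1) _ _]mxE ee !quad_delta.
  by field; rewrite gt_eqF.
by rewrite subr_ge0 -[_^-1]mul1r ler_pdivrMr // mulrC.
Qed.

(** * Symmetric and skew parts, and the determinant bound *)

Lemma SymDSkew (R : realType) (n : nat) (A : 'M[R]_n) : Sym A + Skew A = A.
Proof. by apply/matrixP => i j; rewrite !mxE; field. Qed.

Lemma SymBSkew (R : realType) (n : nat) (A : 'M[R]_n) : Sym A - Skew A = A^T.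
Proof. by apply/matrixP => i j; rewrite !mxE; field. Qed.

Lemma tr_Sym (R : realType) (n : nat) (A : 'M[R]_n) : (Sym A)^T = Sym A.
Proof. by apply/matrixP => i j; rewrite !mxE addrC. Qed.

Lemma tr_Skew (R : realType) (n : nat) (A : 'M[R]_n) : (Skew A)^T = - Skew A.
Proof. by apply/matrixP => i j; rewrite !mxE; ring. Qed.

Lemma Sym_diag (R : realType) (n : nat) (A : 'M[R]_n) (i : 'I_n) :
  Sym A i i = A i i.
Proof. by rewrite !mxE; field. Qed.

(** Row [i] of [Sym A] is the mean of row [i] and column [i] of [A], so averaging the two dominance
    conditions gives row dominance of [Sym A] with the same diagonal. *)
Lemma Sym_posdef (R : realType) (n : nat) (A : 'M[R]_n) :
  doubly_diag_dominant A -> (forall i, 0 < A i i) -> posdef (Sym A).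
Proof.
move=> [rA cA] pA; apply: diag_dominant_posdef; first exact: tr_Sym.
  by move=> i; rewrite Sym_diag.
move=> i; rewrite Sym_diag.
have := cA i; rewrite mxE; have := rA i.
set r := \sum_(j | _) _ => hr; set c := \sum_(j | _) _ => hc.
apply: (@le_lt_trans _ _ (2^-1 * (r + c))); last by lra.
rewrite -big_split mulr_sumr; apply: ler_sum => j _ /=.
by rewrite !mxE normrM gtr0_norm ?invr_gt0 // ler_pM2l ?invr_gt0 // ler_normD.
Qed.

Theorem theorem15 (R : realType) (n : nat) (A : 'M[R]_n)
    (hdom : doubly_diag_dominant A)
    (hpos : forall i : 'I_n, 0 < A i i) :
  \det A <=
    ((operator_norm (Skew A) * operator_norm (invmx (Sym A))) ^+ 2 + 1)
      `^ (n%:R / 2) * \prod_(i < n) A i i.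
Proof.
have hS := Sym_posdef hdom hpos; have uS := posdef_unitmx hS.
have hV := posdef_invmx hS.
set S := Sym A in hS uS hV *; set K := Skew A; set V := invmx S in hV *.
set k := operator_norm K; set v := operator_norm V.
pose P := S + K^T *m V *m K.
have PE : P = A *m V *m A^T.
  have -> : A *m V *m A^T = (S + K) *m V *m (S - K).
    by rewrite SymDSkew SymBSkew.
  (* The product expands to [S + K - K - K V K], and the terms linear in [K] cancel. *)
  rewrite /P tr_Skew mulmxDl mulmxV // mulmxBr !mulmxDl mulmxKV //.
  by rewrite !mul1mx !mulNmx opprD addrA addrK.
have hP : posdef P.
  split.
    by rewrite /P linearD /= !trmx_mul trmxK trmx_inv tr_Sym mulmxA.
  move=> x x0; rewrite /P mulmxDr mulmxDl mxE ltr_wpDr //; last exact: hS.2.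
  by rewrite !mulmxA -trmx_mul -mulmxA; exact: posdef_ge0.
have detE : \det A ^+ 2 = \det S * \det P.
  rewrite PE !det_mulmx det_tr det_inv; field.
  by move: uS; rewrite unitmxE unitfE.
have v1 i : 1 <= v * A i i.
  by rewrite -Sym_diag; exact: operator_norm_invmx_diag.
have Pdiag i : P i i <= ((k * v) ^+ 2 + 1) * A i i.
  have -> : P i i = A i i + (K^T *m V *m K) i i by rewrite /P mxE Sym_diag.
  rewrite mulrDl mul1r addrC lerD2r -(quad_delta (K^T *m V *m K)).
  rewrite !mulmxA -trmx_mul -mulmxA.
  set e := delta_mx i 0.
  apply: le_trans (operator_norm_quad _ _) _; rewrite -/v.
  have Ke : euclidean_norm (K *m e) <= k.
    by apply: operator_norm_unit; exact: euclidean_norm_delta.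
  (* The sign of the supremum [v] follows from [1 <= v * A i i] and [0 < A i i]. *)
  have v0 : 0 <= v.
    by have := lt_le_trans ltr01 (v1 i); rewrite pmulr_lgt0 // => /ltW.
  apply: (@le_trans _ _ (v * k ^+ 2)).
    by rewrite ler_wpM2l // lerXn2r ?nnegrE ?euclidean_norm_ge0 //
      (le_trans _ Ke) ?euclidean_norm_ge0.
  rewrite (_ : _ * _ * A i i = v * k ^+ 2 * (v * A i i)); last by ring.
  by rewrite ler_peMr // mulr_ge0 ?sqr_ge0.
have /andP[dS0 dS] := hadamard_posdef hS.
have /andP[dP0 dP] := hadamard_posdef hP.
set t := (k * v) ^+ 2 + 1 in Pdiag *.
have t0 : 0 <= t by rewrite addr_ge0 ?sqr_ge0.
have prod0 : 0 <= \prod_i A i i by apply: prodr_ge0 => i _; exact: ltW.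
(* Passing to the absolute value of [\det A] makes both sides nonnegative, so they can be squared;
   the exponent [n / 2] then becomes the natural number [n]. *)
apply: le_trans (ler_norm _) _.
rewrite -(@ler_pXn2r _ 2) ?nnegrE ?mulr_ge0 ?powR_ge0 //.
rewrite real_normK ?num_real // detE exprMn -(powR_mulrn 2) ?powR_ge0 //.
rewrite -powRrM divfK ?pnatr_eq0 // powR_mulrn //.
(* The split matches the two Hadamard bounds: the first product is for [\det S], and the second
   absorbs all [n] factors [t] for [\det P]. *)
have -> : t ^+ n * (\prod_i A i i) ^+ 2 =
    (\prod_i A i i) * \prod_(i < n) (t * A i i).
  by rewrite big_split /= prodr_const card_ord; ring.
apply: ler_pM; [exact: ltW|exact: ltW| |].
  apply: le_trans dS _; rewrite (eq_bigr (fun i => A i i)) // => i _.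
  exact: Sym_diag.
apply: le_trans dP _; apply: ler_prod => i _.
by rewrite Pdiag ltW // posdef_diag.
Qed.
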